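(* Let $G$ be a connected graph of order $n$ with minimum degree $\delta$. Then $tpc(G)\leq \frac{3n}{\delta+1}+1$.
   Context: All graphs are simple, finite and undirected. A graph is total-colored if every vertex and every edge receives a color. A path $v_1v_2\ldots v_s$ in a total-colored graph is a total proper path if (i) any two adjacent edges on the path have different colors, (ii) any two adjacent internal vertices of the path (vertices among $v_2,\ldots,v_{s-1}$) have different colors, and (iii) every internal vertex of the path has a color different from the colors of its two incident edges on the path. A total-colored graph is total proper connected if every two vertices are joined by a total proper path. For a connected graph $G$, the total proper connection number $tpc(G)$ is the smallest number of colors in a total-coloring making $G$ total proper connected. *)

(* Defs.v *)
From mathcomp Require Import all_boot.
From mathcomp Require Import boolp.

Set Implicit Arguments.
Unset Strict Implicit.
Unset Printing Implicit Defensive.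

Record sgraph := SGraph {
  vertex :> finType;
  adj : rel vertex;
  adj_sym : symmetric adj;
  adj_irr : irreflexive adj
}.

Definition degree (G : sgraph) (x : G) : nat := #|[set y | adj x y]|.

(* Every degree is less than #|G|, so the default value #|G| does not affect
   the minimum of a nonempty graph. *)
Definition min_degree (G : sgraph) : nat := \big[minn/#|G|]_(x : G) degree x.

Definition connected (G : sgraph) : Prop :=
  0 < #|G| /\ forall x y : G, connect (@adj G) x y.

(* An edge uv is the set [set u; v]; the values of [ecol] on sets that are not
   edges are never used. *)
Record total_coloring (G : sgraph) (k : nat) := TotalColoring {
  vcol : G -> 'I_k;
  ecol : {set G} -> 'I_k
}.

(* The path is x :: p, that is v_0 v_1 ... v_(size p); its internal vertices
   are the v_i with 0 < i < size p. *)
Definition total_proper_path (G : sgraph) (k : nat) (c : total_coloring G k)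
    (x : G) (p : seq G) : Prop :=
  let v i := nth x (x :: p) i in
  let edge i := [set v i; v i.+1] in
  [/\ path (@adj G) x p /\ uniq (x :: p),
      forall i, i.+1 < size p -> ecol c (edge i) <> ecol c (edge i.+1),
      forall i, 0 < i -> i.+1 < size p -> vcol c (v i) <> vcol c (v i.+1)
    & forall i, 0 < i -> i < size p ->
        vcol c (v i) <> ecol c (edge i.-1) /\ vcol c (v i) <> ecol c (edge i)].

Definition total_proper_connected (G : sgraph) (k : nat)
    (c : total_coloring G k) : Prop :=
  forall x y : G, x <> y ->
    exists p : seq G, total_proper_path c x p /\ last x p = y.

Definition tpc_colorable (G : sgraph) (k : nat) : Prop :=
  exists c : total_coloring G k, total_proper_connected c.

Lemma tpc_colorable_ex (G : sgraph) :
  connected G -> exists k, `[< tpc_colorable G k >].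
Proof.
case=> _ cG; exists (#|G| + #|{set G}|); apply/asboolP.
exists (TotalColoring (fun x => lshift _ (enum_rank x))
                      (fun A => rshift _ (enum_rank A))) => x y _.
case/connectP: (cG x y) => p0 + -> => /shortenP[p Pp Up _].
exists p; split=> //; split=> //=.
- move=> i ip /rshift_inj/enum_rank_inj E.
  have : nth x (x :: p) i \in [set nth x (x :: p) i.+1; nth x (x :: p) i.+2].
    by rewrite -E set21.
  have ip1 := ltnW ip; have ip2 := ltnW ip1.
  by rewrite in_set2 !nth_uniq //= !eqn_leq !ltnn ltnNge leqnSn !andbF.
- move=> i i0 ip /lshift_inj/enum_rank_inj/eqP.
  have ip1 := ltnW ip; have ip2 := ltnW ip1.
  by rewrite -[nth x p i]/(nth x (x :: p) i.+1) nth_uniq //= eqn_leq ltnn andbF.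
- move=> i _ _; split=> /eqP; by rewrite eq_lrshift.
Qed.

Definition tpc (G : sgraph) (cG : connected G) : nat :=
  ex_minn (tpc_colorable_ex cG).

(* Main.v *)
(* The bound K = floor(3n/(delta+1)) is at least 3, and a tree of maximum degree
   at most K has a proper total coloring with K+1 colors, obtained from the root
   downwards; in such a coloring every path of the tree is total proper. So it
   suffices to find a spanning tree of maximum degree at most K, which is done
   by local improvement of the total excess of the degrees over K.

   Let v have degree more than K in a spanning tree, and let x be a deepest
   vertex (hence a leaf) of a branch at v with top c. If x has a G-neighbor w in
   another branch with tree degree less than K, then exchanging the edge vc for
   xw decreases the excess. If no branch allows this, then every closed
   neighborhood N[x] lies in the union of the branch of x and of the set B of
   vertices of tree degree at least K. With b = |B| and d = delta+1, summing
   over more than K branches gives (K+1)(d-b) <= n-b, and the degree sum of the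
   tree gives b(K-1) <= n-2. As K >= 3, this yields 2(K+1)d <= 5n, against the
   choice of K. *)
Require Import Defs.
From mathcomp Require Import all_boot all_order all_algebra zify.

Set Implicit Arguments.
Unset Strict Implicit.
Unset Printing Implicit Defensive.

Import Order.TTheory GRing.Theory Num.Theory.

(** * Connected spanning subgraphs and breadth-first trees *)

Section SpanningTrees.
Variable T : finType.
Implicit Types (t : rel T) (f : T -> T) (dep : T -> nat) (r x y z : T).

Definition rel_degree t x : nat := #|[set y | t x y]|.

Definition excess K t : nat := \sum_x (rel_degree t x - K).

(** Cycles are allowed, so that an exchange of edges only has to preserve connectedness; [bfs_tree]
    extracts a tree anew in each round. *)
Definition spanning t : Prop := symmetric t /\ forall x y, connect t x y.

(** The depth certifies that iterating the parent map [f] leads from every vertex to r; the value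
    [f r] is arbitrary. *)
Definition rooted_tree r f dep : Prop :=
  dep r = 0 /\ forall y, y != r -> dep y = (dep (f y)).+1.

Definition tree_rel r f : rel T :=
  [rel y z | (y != r) && (f y == z) || (z != r) && (f z == y)].

Lemma spanning_root t r :
  symmetric t -> (forall y, connect t r y) -> spanning t.
Proof.
move=> st ct; split=> // x y; apply: connect_trans (ct y).
by rewrite (sym_connect_sym st).
Qed.

Lemma rel_degreeS t1 t2 x :
  (forall y, t1 x y -> t2 x y) -> rel_degree t1 x <= rel_degree t2 x.
Proof.
by move=> s12; apply/subset_leq_card/subsetP=> y; rewrite !inE => /s12.
Qed.

Lemma excessS K t1 t2 : subrel t1 t2 -> excess K t1 <= excess K t2.
Proof.
by move=> s12; apply: leq_sum => x _; apply/leq_sub2r/rel_degreeS=> y /s12.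
Qed.

(** The depth is the distance from r. All neighbors of r become its children, so an overfull vertex
    chosen as root keeps its degree in the tree. *)
Lemma bfs_tree t r : spanning t -> irreflexive t ->
  exists f dep, [/\ rooted_tree r f dep, forall y, y != r -> t y (f y)
                  & forall y, t r y -> f y = r].
Proof.
move=> [st ct] it.
pose P y n := [exists p : n.-tuple T, path t r p && (last r p == y)].
have PP y n p : path t r p -> last r p = y -> size p = n -> P y n.
  move=> tp lp <-; apply/existsP; exists (in_tuple p).
  by rewrite tp lp eqxx.
have exP y : exists n, P y n.
  by have /connectP[p tp ->] := ct r y; exists (size p); apply: PP tp _ _.
pose dep y := ex_minn (exP y).
have dep_le y z : t y z -> dep z <= (dep y).+1.
  move=> tyz; rewrite /dep; case: ex_minnP => m _ minm; case: ex_minnP => k.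
  move=> /existsP[p /andP[tp /eqP lp]] _; apply: minm.
  apply: (PP _ _ (rcons p z)); rewrite ?last_rcons //.
    by rewrite rcons_path tp lp.
  by rewrite size_rcons size_tuple.
have depr : dep r = 0.
  rewrite /dep; case: ex_minnP => m _ /(_ 0) H; apply/eqP; rewrite -leqn0.
  by apply: H; apply: (PP _ _ [::]).
have dep0 y : dep y = 0 -> y = r.
  rewrite /dep; case: ex_minnP => m + _ m0; rewrite m0.
  by case/existsP=> p /andP[_ /eqP <-]; rewrite tuple0.
have ex_par y : y != r -> exists z, t y z && (dep y == (dep z).+1).
  move=> yr; have : P y (dep y) by rewrite /dep; case: ex_minnP.
  case/existsP=> -[p /= /eqP]; case/lastP: p => [|p z] sp.
    by move/eqP: yr; rewrite (dep0 y) // -sp.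
  rewrite last_rcons rcons_path => /andP[/andP[tp tz] /eqP zy].
  have tly : t (last r p) y by rewrite -zy.
  exists (last r p); rewrite st tly eqn_leq dep_le //= -sp size_rcons ltnS.
  by rewrite /dep; case: ex_minnP => m _; apply; apply: PP tp _ _.
pose f y := odflt r [pick z | t y z && (dep y == (dep z).+1)].
have fP y : y != r -> t y (f y) && (dep y == (dep (f y)).+1).
  rewrite /f => /ex_par[z Hz]; case: pickP => //= /(_ z); by rewrite Hz.
exists f, dep; split; first split=> //.
- by move=> y /fP/andP[_ /eqP].
- by move=> y /fP/andP[].
- move=> y try; have yr : y != r by apply: contraTneq try => ->; rewrite it.
  have /andP[_ /eqP dy] := fP _ yr; apply: dep0.
  by have := dep_le _ _ try; rewrite dy depr ltnS leqn0 => /eqP.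
Qed.

Lemma tree_rel_sym r f : symmetric (tree_rel r f).
Proof. by move=> x y; rewrite /tree_rel /= orbC. Qed.

Lemma tree_rel_parent r f y : y != r -> tree_rel r f y (f y).
Proof. by move=> yr; rewrite /tree_rel /= yr eqxx. Qed.

Lemma tree_relS t r f : symmetric t -> (forall y, y != r -> t y (f y)) ->
  subrel (tree_rel r f) t.
Proof.
move=> st tf x y /orP[] /andP[/tf + /eqP E]; rewrite E //.
by rewrite st.
Qed.

(** * Rooted trees, their branches, and the exchange of an edge *)

Section Rooted.
Variables (r : T) (f : T -> T) (dep : T -> nat).
Hypothesis tree_f : rooted_tree r f dep.

Lemma tree_ind (P : T -> Prop) :
  P r -> (forall y, y != r -> P (f y) -> P y) -> forall y, P y.
Proof.
case: tree_f => dr df Pr Pf y.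
elim: {y}(dep y) {-2}y (erefl (dep y)) => [|n IHn] y dy;
  case: (eqVneq y r) => [->//|yr]; move: (df _ yr); rewrite dy // => -[dfy].
by apply: Pf => //; apply: IHn.
Qed.

Lemma tree_rel_spanning : spanning (tree_rel r f).
Proof.
apply: (@spanning_root _ r); first exact: tree_rel_sym.
apply: tree_ind => // y yr rfy; apply: connect_trans rfy (connect1 _).
by rewrite tree_rel_sym tree_rel_parent.
Qed.

(** Every vertex other than r is counted twice: for the edge to its parent, and among the children
    of that parent. *)
Lemma sum_tree_degree : \sum_y rel_degree (tree_rel r f) y <= (#|T|.-1).*2.
Proof.
have cr : #|[set y | y != r]| = #|T|.-1.
  by rewrite -(cardsC1 r); apply: eq_card => y; rewrite !inE.
apply: (@leq_trans (\sum_y ((y != r) + #|[set z | (z != r) && (f z == y)]|))).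
  apply: leq_sum => y _; rewrite /rel_degree.
  pose P := [set z | (y != r) && (f y == z)].
  apply: (leq_trans _ (leq_add (_ : #|P| <= _) (leqnn _))).
    apply: leq_trans (leq_card_setU _ _).
    by apply/subset_leq_card/subsetP=> z; rewrite !inE.
  rewrite /P; case: (y != r) => /=; last first.
    by rewrite leqn0 cards_eq0; apply/eqP/setP=> z; rewrite !inE.
  rewrite -(cards1 (f y)); apply/subset_leq_card/subsetP=> z.
  by rewrite !inE eq_sym.
rewrite big_split /= -addnn; apply: leq_add.
  rewrite -cr -sum1_card [X in _ <= X]big_mkcond /=; apply: leq_sum => y _.
  by rewrite inE; case: (y != r).
rewrite -cr -[X in _ <= X]sum1_card [X in _ <= X](partition_big f xpredT) //=.
apply: leq_sum => y _; rewrite -sum1_card leq_eqVlt; apply/orP; left; apply/eqP.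
by apply: eq_bigl=> z; rewrite !inE.
Qed.

(** The ancestor of y at depth 1, which names the branch at r containing y; r is its own branch
    because [0.-1] is 0. *)
Definition branch y : T := iter (dep y).-1 f y.

Lemma branch_root : branch r = r.
Proof. by case: tree_f => dr _; rewrite /branch dr. Qed.

Lemma branch_child y : y != r -> f y = r -> branch y = y.
Proof. by case: tree_f => dr df yr E; rewrite /branch df // E dr. Qed.

Lemma branch_parent y : y != r -> f y != r -> branch (f y) = branch y.
Proof.
case: tree_f => dr df yr fyr; rewrite /branch (df _ yr) (df _ fyr) /=.
by rewrite -iterSr.
Qed.

Lemma branch_top y : y != r -> branch y != r /\ f (branch y) = r.
Proof.
elim/tree_ind: y => [|y yr IH _]; first by rewrite eqxx.
case: (eqVneq (f y) r) => [fyr|fyr]; first by rewrite branch_child.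
by rewrite -branch_parent //; apply: IH.
Qed.

(* The parent edge of c, a child of r, is exchanged for the edge xw. *)
Definition swap c x w : rel T :=
  [rel y z | [|| tree_rel r f y z &&
                   ~~ ((y == r) && (z == c) || (y == c) && (z == r)),
                 (y == x) && (z == w) | (y == w) && (z == x)]].

Lemma swap_sym c x w : symmetric (swap c x w).
Proof.
move=> y z; rewrite /swap /= (tree_rel_sym r f z y).
congr (_ && ~~ _ || _); last by rewrite orbC ![(z == _) && _]andbC.
by rewrite orbC ![(z == _) && _]andbC.
Qed.

(** Surviving parent edges join the vertices outside the branch of c to r, and those inside it to c;
    the new edge xw links the two pieces. *)
Lemma swap_spanning c x w : c != r -> f c = r ->
  branch x = c -> branch w != c -> spanning (swap c x w).
Proof.
move=> cr fc bx bw; have sw := swap_sym c x w.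
have step y : y != r -> y != c -> swap c x w (f y) y.
  move=> yr yc; rewrite sw /swap /= tree_rel_parent //=.
  by rewrite (negPf yr) (negPf yc).
have out y : branch y != c -> connect (swap c x w) r y.
  elim/tree_ind: y => // y yr IH; case: (eqVneq (f y) r) => [E|fyr].
    rewrite branch_child // => yc; apply: connect1.
    by rewrite -{1}E; apply: step.
  move=> byc; apply: connect_trans (IH _) _; first by rewrite branch_parent.
  apply/connect1/step => //; apply: contraNneq fyr => ->; exact/eqP.
have ins y : branch y = c -> connect (swap c x w) c y.
  elim/tree_ind: y => [|y yr IH].
    by rewrite branch_root => E; rewrite E eqxx in cr.
  case: (eqVneq (f y) r) => [E|fyr]; first by rewrite branch_child // => ->.
  rewrite -branch_parent // => /IH H; apply: connect_trans H _.
  apply/connect1/step => //; apply: contraNneq fyr => ->; exact/eqP.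
apply: (@spanning_root _ r) => // y.
case: (eqVneq (branch y) c) => [/ins H|/out //].
apply: connect_trans (out w bw) _; apply: connect_trans _ H.
apply: (@connect_trans _ _ x).
  by apply: connect1; rewrite /swap /= !eqxx !orbT.
by rewrite (sym_connect_sym sw); apply: ins.
Qed.

(** The degree of r exceeds K and drops, the leaf x ends with degree at most 2, w had room for one
    more edge, and no other vertex gains an edge. *)
Lemma excess_swap K c x w : 1 < K -> c != r -> f c = r ->
  branch x = c -> branch w != c -> (forall z, z != r -> f z != x) ->
  rel_degree (tree_rel r f) w < K -> K < rel_degree (tree_rel r f) r ->
  excess K (swap c x w) < excess K (tree_rel r f).
Proof.
move=> K1 cr fc bx bw leafx dw dr.
have xr : x != r by apply: contraNneq cr => E; rewrite -bx E branch_root.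
have wr : w != r by apply: contraTneq dw => ->; lia.
have xw : x != w by apply: contraNneq bw => <-; rewrite bx.
rewrite /excess (bigD1 r) //= [X in _ < X](bigD1 r) //= -addSn; apply: leq_add.
  suff : rel_degree (swap c x w) r < rel_degree (tree_rel r f) r by lia.
  apply/proper_card/properP; split.
    apply/subsetP=> z; rewrite !inE /swap /tree_rel /= !eqxx.
    by rewrite ![r == _]eq_sym (negPf xr) (negPf wr) /= !orbF => /andP[].
  exists c; rewrite !inE /swap /tree_rel /= cr fc !eqxx ?orbT //=.
  by rewrite ![r == _]eq_sym (negPf xr) (negPf wr).
apply: leq_sum => y yr.
case: (eqVneq y x) => [->|yx].
  suff : rel_degree (swap c x w) x <= 2 by lia.
  apply: leq_trans (_ : #|[set f x; w]| <= 2); last first.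
    by rewrite cards2; case: (_ != _).
  apply/subset_leq_card/subsetP=> z; rewrite !inE /swap /tree_rel /=.
  rewrite xr eqxx (negPf xw) /= orbF.
  case/orP=> [/andP[/orP[/eqP->|/andP[/leafx/negPf->//]] _]|->];
    by rewrite ?eqxx ?orbT.
case: (eqVneq y w) => [->|yw].
  suff : rel_degree (swap c x w) w <= (rel_degree (tree_rel r f) w).+1 by lia.
  rewrite -add1n -(cards1 x); apply: leq_trans (leq_card_setU _ _).
  apply/subset_leq_card/subsetP=> z; rewrite !inE /swap /tree_rel /=.
  rewrite eqxx [w == x]eq_sym (negPf xw) /=.
  by case/orP=> [/andP[->]|->]; rewrite ?orbT.
apply/leq_sub2r/rel_degreeS => z.
rewrite /swap /= (negPf yx) (negPf yw) /= !orbF.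
by case/andP.
Qed.

End Rooted.

(** * Local improvement down to maximum degree at most K *)

Lemma spanning_degree_gt0 t x : spanning t -> 1 < #|T| -> 0 < rel_degree t x.
Proof.
move=> [_ ct] T1.
have /card_gt0P[y] : 0 < #|[set~ x]| by rewrite cardsC1; lia.
rewrite !inE => yx; have /connectP[[|z p] /=] := ct x y.
  by move=> _ E; rewrite E eqxx in yx.
by case/andP=> txz _ _; apply/card_gt0P; exists z; rewrite inE.
Qed.

Lemma sum_fibers_le (A C : {set T}) (g : T -> T) :
  \sum_(c in C) #|[set y in A | g y == c]| <= #|A|.
Proof.
rewrite -[X in _ <= X]sum1_card [X in _ <= X](partition_big g xpredT) //=.
rewrite [X in _ <= X](bigID (mem C)) /=; apply: leq_trans (leq_addr _ _).
apply: leq_sum => c _; rewrite -sum1_card leq_eqVlt; apply/orP; left; apply/eqP.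
by apply: eq_bigl => y; rewrite !inE.
Qed.

Section Improvement.
Variables (e : rel T) (d K : nat).
Hypotheses (e_sym : symmetric e) (e_irr : irreflexive e).
Hypothesis e_deg : forall x, d <= rel_degree e x.
Hypotheses (K_gt2 : 2 < K) (K_large : 3 * #|T| < K.+1 * d.+1).

Lemma leaf_swap_exists v f dep :
  rooted_tree v f dep -> K < rel_degree (tree_rel v f) v ->
  exists x w, [/\ x != v, forall z, z != v -> f z != x, e x w,
    branch f dep w != branch f dep x & rel_degree (tree_rel v f) w < K].
Proof.
move=> tf dv; set tr := tree_rel v f in dv *; set br := branch f dep.
have [/existsP[x /existsP[w /and5P[xv /forallP lx exw bw dw]]]|noswap] :=
  boolP [exists x, exists w, [&& x != v, [forall z, (z != v) ==> (f z != x)],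
    e x w, br w != br x & rel_degree tr w < K]].
  by exists x, w; split=> // z; apply/implyP/lx.
exfalso; have [_ df] := tf.
pose B := [set y | K <= rel_degree tr y]; pose C := [set c | tr v c].
(* A deepest vertex x of the branch has at least d+1 closed neighbors; one outside both [B] and the
   branch would allow an exchange. *)
have fiber c : c \in C -> d.+1 - #|B| <= #|[set y in ~: B | br y == c]|.
  rewrite inE /tr /tree_rel /= eqxx /= => /andP[cv /eqP fc].
  have brc : br c == c by rewrite /br (branch_child tf).
  case: (@arg_maxnP _ c (fun y => br y == c) dep brc) => x /eqP bx maxx.
  have xv : x != v.
    by apply: contraNneq cv => E; rewrite -bx E /br (branch_root tf).
  (* A child of x would be a deeper vertex of the same branch. *)
  have leafx z : z != v -> f z != x.
    move=> zv; apply/eqP=> fz; have := maxx z.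
    rewrite /br -(branch_parent tf) ?fz // -/br bx eqxx => /(_ isT).
    by rewrite (df _ zv) fz /= ltnn.
  rewrite leq_subLR; apply: leq_trans (leq_card_setU _ _).
  apply: (@leq_trans #|x |: [set y | e x y]|).
    by rewrite cardsU1 inE e_irr add1n ltnS e_deg.
  apply/subset_leq_card/subsetP=> w; rewrite !inE.
  case: leqP => //= dw /orP[/eqP->|exw]; first by rewrite bx.
  apply: contraNT noswap => bw.
  apply/existsP; exists x; apply/existsP; exists w.
  rewrite xv exw bx bw dw !andbT /=.
  by apply/forallP=> z; apply/implyP/leafx.
have cardB : #|B| + #|~: B| = #|T| by rewrite cardsC.
have cardC : #|C| * (d.+1 - #|B|) <= #|~: B|.
  apply: leq_trans (sum_fibers_le _ C br); rewrite -sum_nat_const.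
  exact: leq_sum.
have dC : K < #|C| by [].
have T1 : 1 < #|T| by have := max_card C; lia.
have degs : #|B| * K + #|~: B| <= (#|T|.-1).*2.
  apply: leq_trans (sum_tree_degree v f).
  rewrite (bigID (mem B)) /= -sum_nat_const -sum1_card; apply: leq_add.
    by apply: leq_sum => y; rewrite inE.
  rewrite (eq_bigl (fun y => y \notin B)) => [|y]; last by rewrite inE.
  apply: leq_sum => y _; apply: spanning_degree_gt0 => //.
  exact: (tree_rel_spanning tf).
have : K.+1 * (d.+1 - #|B|) <= #|~: B|.
  by apply: leq_trans cardC; rewrite leq_mul2r dC orbT.
(* With b = |B| and n = |T|, this gives (K+1)(d+1) <= n + Kb, also when the truncated difference is
   0. From [degs], (K-1)b <= n-2, and 2K <= 3(K-1) as K >= 3, so 2(K+1)(d+1) <= 5n-6. *)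
have : K.+1 * d.+1 <= K.+1 * (d.+1 - #|B|) + K.+1 * #|B|.
  by rewrite -mulnDr leq_mul2l; lia.
nia.
Qed.

(** Passing to a breadth-first tree from an overfull vertex only deletes edges elsewhere, so the
    excess does not grow before the exchange lowers it. *)
Lemma excess_decrease t : spanning t -> subrel t e -> 0 < excess K t ->
  exists t', [/\ spanning t', subrel t' e & excess K t' < excess K t].
Proof.
move=> spt te ex0.
have [v dv] : exists v, K < rel_degree t v.
  have [v dv|dK] := pickP (fun v => K < rel_degree t v); first by exists v.
  suff: excess K t = 0 by lia.
  by apply: big1 => v _; move: (dK v); lia.
have t_irr : irreflexive t by move=> y; apply/negP=> /te; rewrite e_irr.
have [f [dep [tf ft fv]]] := bfs_tree v spt t_irr.
have tr_t := tree_relS spt.1 ft.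
have dv' : K < rel_degree (tree_rel v f) v.
  apply: leq_trans dv _; apply: rel_degreeS => y tvy.
  rewrite tree_rel_sym -{2}(fv y tvy); apply: tree_rel_parent.
  by apply: contraTneq tvy => ->; rewrite t_irr.
have [x [w [xv leafx exw bw dw]]] := leaf_swap_exists tf dv'.
have [cv fc] := branch_top tf xv.
exists (swap v f (branch f dep x) x w); split.
- exact: (swap_spanning tf).
- move=> y z /or3P[/andP[/tr_t/te]||] // /andP[/eqP-> /eqP->] //.
  by rewrite e_sym.
- apply: leq_trans (excessS K tr_t).
  exact: (excess_swap tf (ltnW K_gt2)).
Qed.

Lemma spanning_rel_degree_le : spanning e ->
  exists t, [/\ spanning t, subrel t e & forall x, rel_degree t x <= K].
Proof.
move=> spe; suff [t [spt te ex0]] :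
    exists t, [/\ spanning t, subrel t e & excess K t = 0].
  exists t; split=> // x; rewrite -subn_eq0.
  by move/eqP: ex0; rewrite sum_nat_eq0 => /forallP/(_ x).
suff H m t : excess K t <= m -> spanning t -> subrel t e ->
    exists t, [/\ spanning t, subrel t e & excess K t = 0] by exact: H spe _.
elim: m t => [|m IHm] t exm spt te;
  have [ex0|ex_gt0] := posnP (excess K t); try by exists t.
  by move: exm; rewrite leqNgt ex_gt0.
have [t' [spt' te' lt_ex]] := excess_decrease spt te ex_gt0.
by apply: (IHm t') => //; rewrite -ltnS; apply: leq_trans exm.
Qed.

End Improvement.

End SpanningTrees.

(** * Proper total colorings of rooted trees *)

Section TreeColoring.
Variables (T : finType) (r : T) (f : T -> T) (dep : T -> nat).
Hypothesis tree_f : rooted_tree r f dep.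

(** Recursion from the root downwards, with the depth as fuel. *)
Lemma tree_rec (A : Type) (a : A) (step : T -> A -> A) :
  exists g, g r = a /\ forall y, y != r -> g y = step y (g (f y)).
Proof.
have [dr df] := tree_f.
pose F := fix F n y := if n is m.+1 then step y (F m (f y)) else a.
exists (fun y => F (dep y) y); split=> [|y yr]; first by rewrite dr.
by rewrite (df _ yr).
Qed.

Lemma grandparent_neq y : y != r -> f y != r -> f (f y) != y.
Proof.
have [_ df] := tree_f => yr fyr; apply/eqP=> E.
by have := df _ fyr; rewrite E (df _ yr); lia.
Qed.

(** Otherwise y and z would be parents of each other. Hence a tree edge can be indexed by its lower
    end. *)
Lemma edge_set_inj y z : y != r -> z != r ->
  [set y; f y] = [set z; f z] -> y = z.
Proof.
move=> yr zr E.
have : y \in [set z; f z] by rewrite -E set21.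
have : z \in [set y; f y] by rewrite E set21.
rewrite !in_set2 => /orP[/eqP//|/eqP zy] /orP[/eqP//|/eqP yz].
have fyr : f y != r by rewrite -zy.
by have := grandparent_neq yr fyr; rewrite -zy -yz eqxx.
Qed.

Definition children y : {set T} := [set z | (z != r) && (f z == y)].

Lemma card_children y :
  (y != r) + #|children y| <= rel_degree (tree_rel r f) y.
Proof.
case: (eqVneq y r) => [_|yr] /=.
  apply/subset_leq_card/subsetP=> z.
  by rewrite !inE /tree_rel /= => ->; rewrite orbT.
have fyN : f y \notin children y.
  by rewrite inE; apply/negP=> /andP[/(grandparent_neq yr)/negPf->].
have := cardsU1 (f y) (children y); rewrite fyN /= => <-.
apply/subset_leq_card/subsetP=> z; rewrite !inE /tree_rel /= yr eq_sym.
by case/orP=> ->; rewrite ?orbT.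
Qed.

(** Here [e y] colors the edge from y to its parent. At a vertex other than r, its own color and
    that of its parent edge leave at least K-1 colors for the edges to at most K-1 children. *)
Lemma tree_total_coloring K : 1 < K ->
  (forall y, rel_degree (tree_rel r f) y <= K) ->
  exists c e : T -> 'I_K.+1,
  [/\ forall y, y != r -> [/\ c y <> c (f y), c y <> e y & c (f y) <> e y],
      forall y, y != r -> f y != r -> e y <> e (f y)
    & forall y z, y != r -> z != r -> y <> z -> f y = f z -> e y <> e z].
Proof.
move=> K1 degK.
pose free (a b : 'I_K.+1) := enum (~: [set a; b]).
have size_free a b : size (free a b) = K - (a != b).
  rewrite /free -cardE; have := cardsC [set a; b].
  by rewrite cards2 card_ord; case: (a != b); lia.
have nth_free a b i : i < size (free a b) ->
    nth ord0 (free a b) i <> a /\ nth ord0 (free a b) i <> b.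
  move=> /(mem_nth ord0); rewrite mem_enum !inE => /norP[/eqP ? /eqP ?].
  by split.
(* Siblings take distinct entries of the same list of free colors, according to their rank among the
   children. *)
pose idx z := index z (enum (children (f z))).
pose step z (s : 'I_K.+1 * 'I_K.+1) :=
  let e := nth ord0 (free s.1 s.2) (idx z) in (nth ord0 (free s.1 e) 0, e).
(* The root gets a fictitious parent edge of the same color as itself: it then
   forbids only one color to the edges below, as needed for K children. *)
have [g [gr gE]] := tree_rec (ord0, ord0) step.
have in_children z : z != r -> z \in enum (children (f z)).
  by move=> zr; rewrite mem_enum inE zr eqxx.
have idx_lt z : z != r -> idx z < size (free (g (f z)).1 (g (f z)).2).
  move=> zr; have := in_children z zr; rewrite -index_mem -cardE => lt_idx.
  rewrite size_free; have := leq_trans (card_children (f z)) (degK (f z)).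
  have -> : ((g (f z)).1 != (g (f z)).2) =
            (f z != r) && ((g (f z)).1 != (g (f z)).2).
    by case: (eqVneq (f z) r) => [->|//]; rewrite gr eqxx.
  by rewrite /idx; case: (f z != r); case: (_ != _) => /=; lia.
exists (fun y => (g y).1), (fun y => (g y).2); split.
- move=> y yr; rewrite gE //=; set a := g (f y).
  have [ea eb] := nth_free _ _ _ (idx_lt y yr); rewrite -/a in ea eb.
  set e := nth ord0 (free a.1 a.2) (idx y) in ea eb *.
  have [] := nth_free a.1 e 0.
    by rewrite size_free; case: (_ != _); lia.
  by split=> //; apply/nesym.
- move=> y yr fyr; rewrite gE //=.
  by have [] := nth_free _ _ _ (idx_lt y yr).
- move=> y z yr zr yz fyz; rewrite gE // [in X in _ <> X]gE //= -fyz => /eqP.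
  have ltz := idx_lt z zr; rewrite -fyz in ltz.
  rewrite nth_uniq ?enum_uniq //; last exact: idx_lt.
  rewrite /idx -fyz => /eqP E; apply: yz.
  by rewrite -(nth_index r (in_children y yr)) E fyz nth_index ?in_children.
Qed.

End TreeColoring.

(** * From tree colorings to the bound on [tpc] *)

Lemma spanning_tpc_colorable (G : sgraph) K (t : rel G) : 1 < K ->
  0 < #|G| -> spanning t -> subrel t (@adj G) ->
  (forall x, rel_degree t x <= K) -> tpc_colorable G K.+1.
Proof.
move=> K1 /card_gt0P[r _] spt t_adj degK.
have t_irr : irreflexive t by move=> y; apply/negP=> /t_adj; rewrite adj_irr.
have [f [dep [tf ft _]]] := bfs_tree r spt t_irr.
set tr := tree_rel r f; have tr_t : subrel tr t := tree_relS spt.1 ft.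
have degtr y : rel_degree tr y <= K.
  by apply: leq_trans (degK y); apply: rel_degreeS => z /tr_t.
have [c [e [cP e_par e_sib]]] := tree_total_coloring tf K1 degtr.
(* The default [ord0] falls on sets that are not tree edges; the connecting paths stay in the tree
   and never meet it. *)
pose ec (A : {set G}) :=
  if [pick z | (z != r) && (A == [set z; f z])] is Some z then e z else ord0.
have ecE z : z != r -> ec [set z; f z] = e z.
  move=> zr; rewrite /ec; case: pickP => [y /andP[yr /eqP E]|/(_ z)].
    by rewrite (edge_set_inj tf zr yr E).
  by rewrite zr eqxx.
have ecE' z : z != r -> ec [set f z; z] = e z by rewrite setUC; apply: ecE.
have trP y z : tr y z -> (y != r /\ z = f y) \/ (z != r /\ y = f z).
  by case/orP=> /andP[? /eqP]; [left|right].
(* Two consecutive edges both go up, turn at a common parent, retrace one edge (excluded by a <> b),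
   or both go down. *)
have ec_adj a y b : tr a y -> tr y b -> a <> b ->
    ec [set a; y] <> ec [set y; b].
  case/trP=> [[ar ->]|[yr ->]] /trP[[br E]|[br E]] ab.
  - by rewrite E !ecE //; apply: e_par.
  - by rewrite {2}E ecE // ecE' //; apply: e_sib.
  - by case: ab.
  - rewrite E in yr *; rewrite !ecE' //; exact/nesym/e_par.
have vv a b : tr a b -> c a <> c b.
  by case/trP=> [[+ ->]|[+ ->]] => /cP[] // /nesym.
have ve a b : tr a b -> c a <> ec [set a; b].
  by case/trP=> [[nr ->]|[nr ->]]; rewrite ?ecE ?ecE' //; have [] := cP _ nr.
have ev a b : tr a b -> c b <> ec [set a; b].
  by rewrite /tr tree_rel_sym setUC; apply: ve.
exists (TotalColoring c ec) => x y _.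
have /connectP[p0 + ->] := (tree_rel_spanning tf).2 x y.
case/shortenP=> p trp up _; exists p; split=> //.
have tr_nth i : i < size p -> tr (nth x (x :: p) i) (nth x (x :: p) i.+1).
  by move/(pathP x): trp; apply.
split=> [|i ip|i i0 ip|[//|i] _ ip].
- by split=> //; apply: sub_path trp => a b /tr_t/t_adj.
- apply: ec_adj; [exact/tr_nth/ltnW | exact: tr_nth |].
  by move/eqP; rewrite nth_uniq //=; lia.
- exact/vv/tr_nth/ltnW.
- by split; [apply/ev/tr_nth/ltnW | apply/ve/tr_nth].
Qed.

Lemma min_degree_le (G : sgraph) (x : G) : min_degree G <= degree x.
Proof.
rewrite /min_degree; have := mem_index_enum x.
elim: (index_enum G) => // y s IHs; rewrite inE big_cons geq_min.
by case/orP=> [/eqP->|/IHs ->]; rewrite ?leqnn ?orbT.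
Qed.

Lemma degree_lt_card (G : sgraph) (x : G) : degree x < #|G|.
Proof.
have := cardsU1 x [set y | adj x y]; rewrite inE adj_irr add1n => <-.
exact: max_card.
Qed.

Theorem theorem5 (G : sgraph) (cG : connected G) :
  ((tpc cG)%:R <= 3%:R * #|G|%:R / ((min_degree G)%:R + 1) + 1 :> rat)%R.
Proof.
have [G0 ctG] := cG; have /card_gt0P[x0 _] := G0.
pose K := (3 * #|G|) %/ (min_degree G).+1.
have K_le : K * (min_degree G).+1 <= 3 * #|G| := leq_trunc_div _ _.
(* This amounts to the minimum degree being less than n. *)
have K_gt2 : 2 < K.
  rewrite leq_divRL // leq_mul2l /=.
  exact: leq_ltn_trans (min_degree_le x0) (degree_lt_card x0).
have K_large : 3 * #|G| < K.+1 * (min_degree G).+1 by rewrite ltn_ceil.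
have spG : spanning (@adj G) by split=> //; apply: adj_sym.
have [t [spt t_adj degK]] := spanning_rel_degree_le (@adj_sym G) (@adj_irr G)
  (@min_degree_le G) K_gt2 K_large spG.
have colK := spanning_tpc_colorable (ltnW K_gt2) G0 spt t_adj degK.
have tpc_le : tpc cG <= K.+1.
  by rewrite /tpc; case: ex_minnP => m _; apply; apply/boolp.asboolP.
apply: (@le_trans _ _ (K.+1%:R)%R).
  by rewrite ler_nat.
rewrite -natr1 lerD2r natr1.
rewrite ler_pdivlMr ?ltr0Sn //.
by rewrite -!natrM ler_nat.
Qed.
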